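(* For every integer $m\geq 1$, the variety $\mathsf{Pa}_m$ has exactly one cover in the lattice of quasivarieties of p-algebras, and this cover is $\mathbf{Q}\bigl(\bar{\mathbf{B}}_m,\mathbf{U}_{m+1}\bigr)$.
   Context: A p-algebra is a bounded distributive lattice $(A,\wedge,\vee,0,1)$ endowed with a unary operation ${}^*$ such that $x\wedge y=0$ iff $x\leq y^*$; the signature is $(\wedge,\vee,{}^*,0,1)$. The class of all p-algebras is a variety $\mathsf{Pa}$. For $k\in\mathbb{N}=\{0,1,2,\dots\}$, $\bar{\mathbf{B}}_k$ is the p-algebra whose lattice is the Boolean lattice with $k$ atoms together with one new element added above its top element (so $\bar{\mathbf{B}}_0$ is the two-element Boolean algebra), and $\mathsf{Pa}_k=\mathbf{HSP}(\bar{\mathbf{B}}_k)$ is the variety it generates. For a finite poset $P$, $\varepsilon(P)$ denotes the dual p-algebra of $P$: its elements are the upsets of $P$ ordered by inclusion, with $U^*=\{x\in P:\text{ no } y\geq x \text{ lies in } U\}$. For finite $n\geq 1$, $U_n$ is the poset of all non-empty subsets of an $n$-element set ordered by reverse inclusion ($A\leq B$ iff $B\subseteq A$), and $\mathbf{U}_n=\varepsilon(U_n)$. $\mathbf{Q}(\mathbf{A},\mathbf{B},\dots)$ denotes the quasivariety generated by the listed algebras (quasivarieties contain the trivial algebras). The lattice of quasivarieties of p-algebras is the set of all subquasivarieties of $\mathsf{Pa}$ ordered by inclusion. A quasivariety $\mathsf{K}$ is a cover of $\mathsf{L}$ in this lattice if $\mathsf{L}\subsetneq\mathsf{K}$ and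 no quasivariety of p-algebras lies strictly between $\mathsf{L}$ and $\mathsf{K}$. *)

(* Defs.v *)
From HB Require Import structures.
From Stdlib Require List.
From mathcomp Require Import all_boot all_order.

Set Implicit Arguments.
Unset Strict Implicit.
Unset Printing Implicit Defensive.

Import Order.TTheory Order.DefaultSetSubsetOrder.
Local Open Scope order_scope.

HB.mixin Record hasPseudocomplement (d : Order.disp_t) T
    of Order.TBDistrLattice d T := {
  pcompl : T -> T;
  pcomplP : forall x y : T, (x `&` y == \bot) = (x <= pcompl y)
}.

(* The trivial algebra is allowed: nothing forces \bot != \top. *)
#[short(type="pAlgebraType")]
HB.structure Definition PAlgebra (d : Order.disp_t) :=
  { T of hasPseudocomplement d T & Order.TBDistrLattice d T }.

(* A display carries no information (it only selects notations), so all
   p-algebras are put at one fixed display. *)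
Fact palg_display : Order.disp_t. Proof. exact: Order.Disp tt tt. Qed.

Notation palgebra := (pAlgebraType palg_display).

Definition palg_hom (A B : palgebra) (f : A -> B) : Prop :=
  [/\ {morph f : x y / x `&` y >-> x `&` y},
      {morph f : x y / x `|` y >-> x `|` y},
      {morph f : x / pcompl x >-> pcompl x},
      f \bot = \bot & f \top = \top].

Definition palg_class := palgebra -> Prop.

Definition subclass (K L : palg_class) : Prop := forall A, K A -> L A.

Definition eqclass (K L : palg_class) : Prop := forall A, K A <-> L A.

Definition properclass (K L : palg_class) : Prop :=
  subclass K L /\ ~ subclass L K.

Definition opH (K : palg_class) : palg_class := fun A =>
  exists (B : palgebra) (f : B -> A),
    [/\ K B, palg_hom f & forall a, exists b, f b = a].

Definition opS (K : palg_class) : palg_class := fun A =>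
  exists (B : palgebra) (f : A -> B), [/\ K B, palg_hom f & injective f].

(* [A] is a direct product of the family [B]: the homomorphism
   [a |-> (p i a)_i] from [A] to the product is bijective. *)
Definition opP (K : palg_class) : palg_class := fun A =>
  exists (I : Type) (B : I -> palgebra) (p : forall i, A -> B i),
    [/\ forall i, K (B i), forall i, palg_hom (p i)
      & forall b : (forall i, B i), exists! a, forall i, p i a = b i].

Definition HSP (K : palg_class) : palg_class := opH (opS (opP K)).

Inductive pterm :=
  | TVar of nat
  | TMeet of pterm & pterm
  | TJoin of pterm & pterm
  | TPcompl of pterm
  | TBot
  | TTop.

Fixpoint peval (A : palgebra) (v : nat -> A) (t : pterm) : A :=
  match t with
  | TVar n => v n
  | TMeet t1 t2 => peval v t1 `&` peval v t2
  | TJoin t1 t2 => peval v t1 `|` peval v t2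
  | TPcompl t1 => pcompl (peval v t1)
  | TBot => \bot
  | TTop => \top
  end.

Definition pequation : Type := pterm * pterm.

Definition eq_holds (A : palgebra) (v : nat -> A) (e : pequation) : Prop :=
  peval v e.1 = peval v e.2.

Record quasi_identity := QuasiIdentity {
  qi_premises : seq pequation;
  qi_conclusion : pequation
}.

Definition satisfies (A : palgebra) (q : quasi_identity) : Prop :=
  forall v : nat -> A,
    (forall e, List.In e (qi_premises q) -> eq_holds v e) ->
    eq_holds v (qi_conclusion q).

Definition is_quasivariety (K : palg_class) : Prop :=
  exists Sigma : quasi_identity -> Prop,
    forall A, K A <-> (forall q, Sigma q -> satisfies A q).

Definition quasivariety_generated (G : palg_class) : palg_class := fun A =>
  forall K, is_quasivariety K -> subclass G K -> K A.

(* [K] covers [L] *)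
Definition is_cover (K L : palg_class) : Prop :=
  [/\ is_quasivariety L, is_quasivariety K, properclass L K
    & ~ exists M, [/\ is_quasivariety M, properclass L M & properclass M K]].

(* [None] is the element added above the top of the Boolean lattice. *)

Definition Bbar (k : nat) : Type := option {set 'I_k}.

Section Bbar.
Variable k : nat.

HB.instance Definition _ := Finite.on (Bbar k).

Implicit Types X Y : Bbar k.

Definition Bbar_le X Y : bool :=
  match X, Y with
  | _, None => true
  | None, Some _ => false
  | Some A, Some B => A \subset B
  end.

Definition Bbar_lt X Y : bool := (Y != X) && Bbar_le X Y.

Definition Bbar_meet X Y : Bbar k :=
  match X, Y with
  | None, _ => Y
  | _, None => X
  | Some A, Some B => Some (A :&: B)
  end.

Definition Bbar_join X Y : Bbar k :=
  match X, Y with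
  | Some A, Some B => Some (A :|: B)
  | _, _ => None
  end.

Definition Bbar_pcompl X : Bbar k :=
  match X with
  | None => Some set0
  | Some A => if A == set0 then None else Some (~: A)
  end.

Fact Bbar_leE X Y : Bbar_le X Y = (Bbar_meet X Y == X).
Proof.
case: X Y => [A|] [B|] //=; last by rewrite eqxx.
by rewrite -[RHS]/(A :&: B == A); apply/setIidPl/eqP.
Qed.

Fact Bbar_ltE X Y : Bbar_lt X Y = (Y != X) && Bbar_le X Y.
Proof. by []. Qed.

Fact Bbar_meetC : commutative Bbar_meet.
Proof. by move=> [A|] [B|] //=; rewrite setIC. Qed.

Fact Bbar_joinC : commutative Bbar_join.
Proof. by move=> [A|] [B|] //=; rewrite setUC. Qed.

Fact Bbar_meetA : associative Bbar_meet.
Proof. by move=> [A|] [B|] [C|] //=; rewrite setIA. Qed.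

Fact Bbar_joinA : associative Bbar_join.
Proof. by move=> [A|] [B|] [C|] //=; rewrite setUA. Qed.

Fact Bbar_joinKI Y X : Bbar_meet X (Bbar_join X Y) = X.
Proof. by case: X Y => [A|] [B|] //=; rewrite setUC setKU. Qed.

Fact Bbar_meetKU Y X : Bbar_join X (Bbar_meet X Y) = X.
Proof. by case: X Y => [A|] [B|] //=; rewrite ?setUid // setIC setKI. Qed.

Fact Bbar_meetUl : left_distributive Bbar_meet Bbar_join.
Proof.
by move=> [A|] [B|] [C|] //=; congr Some; rewrite ?setIUl //;
  apply/setP=> x; rewrite !inE; case: (x \in C); rewrite ?orbT ?andbF ?orbF ?andbT.
Qed.

Fact Bbar_meetxx : idempotent_op Bbar_meet.
Proof. by move=> [A|] //=; rewrite setIid. Qed.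

HB.instance Definition _ :=
  Order.isMeetJoinDistrLattice.Build palg_display (Bbar k)
    Bbar_leE Bbar_ltE Bbar_meetC Bbar_joinC Bbar_meetA Bbar_joinA
    Bbar_joinKI Bbar_meetKU Bbar_meetUl Bbar_meetxx.

Fact Bbar_le0x X : (Some set0 : Bbar k) <= X.
Proof. by rewrite -[_ <= _]/(Bbar_le _ _); case: X => //= A; rewrite sub0set. Qed.

Fact Bbar_lex1 X : X <= (None : Bbar k).
Proof. by rewrite -[_ <= _]/(Bbar_le _ _); case: X. Qed.

HB.instance Definition _ := Order.hasBottom.Build _ (Bbar k) Bbar_le0x.
HB.instance Definition _ := Order.hasTop.Build _ (Bbar k) Bbar_lex1.

Fact Bbar_pcomplP X Y : (X `&` Y == \bot) = (X <= Bbar_pcompl Y).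
Proof.
rewrite -[X `&` Y]/(Bbar_meet X Y) -[X <= _]/(Bbar_le _ _).
rewrite -[\bot]/(Some set0 : Bbar k).
case: X Y => [A|] [B|] //=.
- rewrite -[LHS]/(A :&: B == set0); have [->|_] := eqVneq B set0.
    by rewrite setI0 eqxx.
  by rewrite setI_eq0 disjoints_subset.
- by rewrite -[LHS]/(A == set0) subset0.
- by rewrite -[LHS]/(B == set0); case: eqP.
Qed.

HB.instance Definition _ :=
  hasPseudocomplement.Build _ (Bbar k) Bbar_pcomplP.

End Bbar.

Definition Pa (k : nat) : palg_class :=
  HSP (fun A => A = (Bbar k : palgebra)).

Section Upsets.
Variables (d : Order.disp_t) (P : finPOrderType d).

Definition is_upset (U : {set P}) : bool :=
  [forall x in U, forall y, (x <= y) ==> (y \in U)].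

Record upset : Type := Upset { upset_val :> {set P}; _ : is_upset upset_val }.

HB.instance Definition _ := [isSub for upset_val].
HB.instance Definition _ := [Finite of upset by <:].

Lemma upsetP (U : {set P}) :
  reflect (forall x y, x \in U -> x <= y -> y \in U) (is_upset U).
Proof.
apply: (iffP 'forall_in_forallP) => h x.
  by move=> y xU; apply/implyP; exact: h.
by move=> xU y; apply/implyP; exact: h.
Qed.

Fact upset_meet_closed : meet_closed is_upset.
Proof.
move=> U V /upsetP hU /upsetP hV; apply/upsetP=> x y.
rewrite !inE => /andP[xU xV] xy.
by rewrite (hU _ _ xU xy) (hV _ _ xV xy).
Qed.

Fact upset_join_closed : join_closed is_upset.
Proof.
move=> U V /upsetP hU /upsetP hV; apply/upsetP=> x y.
rewrite !inE => /orP[xU|xV] xy; first by rewrite (hU _ _ xU xy).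
by rewrite (hV _ _ xV xy) orbT.
Qed.

Fact upset_bot : (\bot : {set P}) \in is_upset.
Proof. by apply/upsetP=> x y; rewrite inE. Qed.

Fact upset_top : (\top : {set P}) \in is_upset.
Proof. by apply/upsetP=> x y _ _; rewrite inE. Qed.

HB.instance Definition _ :=
  Order.SubChoice_isTBSubLattice.Build _ _ _ palg_display upset
    upset_meet_closed upset_join_closed upset_bot upset_top.

Fact upset_meetUl : left_distributive (@Order.meet _ upset) (@Order.join _ upset).
Proof. by move=> U V W; apply/val_inj; exact: setIUl. Qed.

HB.instance Definition _ :=
  Order.Lattice_Meet_isDistrLattice.Build _ upset upset_meetUl.

Definition upset_pcompl_set (U : upset) : {set P} :=
  [set x | [forall y, (x <= y) ==> (y \notin upset_val U)]].

Fact upset_pcompl_subproof (U : upset) : is_upset (upset_pcompl_set U).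
Proof.
apply/upsetP=> x y; rewrite !inE => /forallP h xy; apply/forallP=> z.
by apply/implyP=> yz; exact: (implyP (h z) (le_trans xy yz)).
Qed.

Definition upset_pcompl (U : upset) : upset := Upset (upset_pcompl_subproof U).

Fact upset_pcomplP (U V : upset) : (U `&` V == \bot) = (U <= upset_pcompl V).
Proof.
rewrite -[LHS]/(upset_val U :&: upset_val V == set0).
rewrite -[RHS]/(upset_val U \subset upset_pcompl_set V).
apply/eqP/subsetP => [UV0 x xU|h].
  rewrite inE; apply/forallP=> y; apply/implyP=> xy; apply/negP=> yV.
  have yU : y \in upset_val U by case: U UV0 xU => U /= /upsetP hU _ /hU; exact.
  by have := in_set0 y; rewrite -UV0 inE yU yV.
apply/setP=> x; rewrite !inE; apply/negP=> /andP[/h].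
by rewrite inE => /forallP/(_ x)/implyP/(_ (lexx x))/negP.
Qed.

HB.instance Definition _ :=
  hasPseudocomplement.Build _ upset upset_pcomplP.

End Upsets.

Definition Uposet (n : nat) : Type := {A : {set 'I_n} | A != set0}.

Section Uposet.
Variable n : nat.

HB.instance Definition _ := Finite.on (Uposet n).

Definition Uposet_le : rel (Uposet n) := fun A B => val B \subset val A.

Fact Uposet_le_refl : reflexive Uposet_le.
Proof. by move=> A; exact: subxx. Qed.

Fact Uposet_le_anti : antisymmetric Uposet_le.
Proof. by move=> A B AB; apply/val_inj/eqP; rewrite eqEsubset andbC. Qed.

Fact Uposet_le_trans : transitive Uposet_le.
Proof. by move=> B A C AB BC; exact: subset_trans BC AB. Qed.

HB.instance Definition _ :=
  Order.Le_isPOrder.Build palg_display (Uposet n)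
    Uposet_le_refl Uposet_le_anti Uposet_le_trans.

End Uposet.

Definition Ualg (n : nat) : palgebra := upset (Uposet n).

(* Main.v *)
Require Import Defs.
From mathcomp Require Import all_boot all_order.
From HB Require Import structures.
From mathcomp Require Import boolp.
From mathcomp Require classical_sets.

(** Everything turns on one quasi-identity: every family of m + 1 pairwise
    disjoint elements b_i satisfies \join_i b_i^* = 1 (a form of Lee's
    identity). Three facts about it give the theorem.

    It axiomatizes Pa_m, and the algebras satisfying it are separated by
    homomorphisms into Bbar_m ([Pa_Lee], [Lee_separated]). Indeed HSP
    preserves the condition and Bbar_m satisfies it, since m + 1 disjoint
    subsets of an m-element set cannot all be non-empty. Conversely, under
    this condition fewer than m + 1 ultrafilters contain a given prime filter
    P: distinct ultrafilters M_i containing P have disjoint members b_i, some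
    b_i^* lies in P, hence in M_i, which is absurd. Sending the members of P
    to the new top of Bbar_m, and every other x to the set of ultrafilters
    above P that contain x, is then a homomorphism, and prime filters separate
    points. So every quasivariety containing Bbar_m contains Pa_m, which is
    itself a quasivariety.

    It fails in U_(m+1), on the m + 1 principal upsets of singletons
    ([Ualg_not_Lee]). So Pa_m is properly contained in Q(Bbar_m, U_(m+1)).

    If it fails in A, then U_(m+1) is in every quasivariety containing A and
    Bbar_m ([Ualg_in_quasivariety]). Two elements of U_(m+1) are upsets that
    disagree on some non-empty set Y. If Y has at most m elements, the prime
    filter of the upsets containing Y lies under at most m ultrafilters, and
    the construction above gives a homomorphism to Bbar_m separating the two.
    Otherwise Y is the full set, the least element of the poset, so exactly
    one of the two upsets is the top; what is needed is a homomorphism to A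
    sending only the top to 1. A failure of the condition can be enlarged to a
    disjoint family c_i with dense join, so that the regular joins r_S of the
    c_i with i in S form a Boolean algebra, and W |-> \join_(S in W) r_S is a
    homomorphism ([Ualg_eval_hom]). It sends an upset other than the top below
    \join_i c_i^* <> 1.

    Hence Q(Bbar_m, U_(m+1)) is contained in every quasivariety properly above
    Pa_m, which makes it a cover and the only one. *)

Section Palgebras.
Import Order.TTheory.
Local Open Scope order_scope.
Set Implicit Arguments.
Unset Strict Implicit.

(** * Pseudocomplements *)

Section Pseudocomplement.
Variable A : palgebra.
Implicit Types (x y z : A).

Lemma le_pcompl x y : (x <= pcompl y) = (x `&` y == \bot).
Proof. by rewrite pcomplP. Qed.

Lemma le_pcomplC x y : (x <= pcompl y) = (y <= pcompl x).
Proof. by rewrite !le_pcompl meetC. Qed.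

Lemma meetx_pcompl x : x `&` pcompl x = \bot.
Proof. by apply/eqP; rewrite meetC pcomplP. Qed.

Lemma pcompl_anti x y : x <= y -> pcompl y <= pcompl x.
Proof.
move=> xy; rewrite le_pcompl -lex0 -(meetx_pcompl y) meetC.
exact: leI2.
Qed.

Lemma pcompl0 : pcompl \bot = \top :> A.
Proof. by apply/eqP; rewrite -le1x le_pcompl meetx0. Qed.

Lemma pcompl1 : pcompl \top = \bot :> A.
Proof. by rewrite -[LHS]meet1x meetx_pcompl. Qed.

Lemma le_pcompl_joins (I : finType) (Q : pred I) (F : I -> A) x :
  x <= pcompl (\join_(i | Q i) F i) <->
  forall i, Q i -> x `&` F i = \bot.
Proof.
rewrite le_pcomplC; split=> [/joinsP xF i Qi|xF].
  by apply/eqP; rewrite -le_pcompl le_pcomplC xF.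
by apply/joinsP => i Qi; rewrite le_pcomplC le_pcompl xF.
Qed.

End Pseudocomplement.

(** * Prime filters and ultrafilters *)

Section PrimeFilters.
Variable A : palgebra.
Implicit Types (x y z b : A) (F P M N : A -> Prop).

Record is_filter F : Prop := Filter {
  filterT : F \top;
  filterI : forall x y, F x -> F y -> F (x `&` y);
  filterS : forall x y, x <= y -> F x -> F y
}.

Record prime_filter P : Prop := PrimeFilter {
  prime_is_filter :> is_filter P;
  prime_proper : ~ P \bot;
  primeU : forall x y, P (x `|` y) -> P x \/ P y
}.

Record ultrafilter M : Prop := Ultrafilter {
  ultra_is_filter :> is_filter M;
  ultra_proper : ~ M \bot;
  ultra_pcompl : forall x, ~ M x -> M (pcompl x)
}.

Lemma principal_filter a : is_filter (fun x => a <= x).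
Proof.
split=> [|x y ax ay|x y xy /le_trans]; rewrite ?lex1 ?lexI ?ax //.
exact.
Qed.

(** The conclusion is the usable form of maximality: the filter generated by P
    and a non-member x must contain b. *)
Lemma exists_maximal_avoiding F b : is_filter F -> ~ F b ->
  exists P, [/\ is_filter P, forall x, F x -> P x, ~ P b
    & forall x, ~ P x -> exists2 p, P p & p `&` x <= b].
Proof.
move=> fF nFb.
(* Filters are presented as F together with X, because the bound of the empty
   chain is the empty set, which is not a filter. *)
pose good (X : A -> Prop) :=
  let G x := F x \/ X x in is_filter G /\ ~ G b.
have chain C : (forall X, C X -> good X) ->
    classical_sets.total_on C (@classical_sets.subset A) ->
    good (classical_sets.bigcup C id).
  move=> Cgood Ctot; split.
    split; first by left; exact: filterT fF.
    - move=> x y [Fx|[X CX Xx]] [Fy|[Y CY Yy]].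
      + by left; exact: (filterI fF).
      + have [[_ GI _] _] := Cgood _ CY.
        have [|Yxy] := GI x y (or_introl Fx) (or_intror Yy); first by left.
        by right; exists Y.
      + have [[_ GI _] _] := Cgood _ CX.
        have [|Xxy] := GI x y (or_intror Xx) (or_introl Fy); first by left.
        by right; exists X.
      + wlog XY : x y X Y CX CY Xx Yy / classical_sets.subset X Y.
          move=> H; have [XY|YX] := Ctot _ _ CX CY; first exact: (H x y X Y).
          by rewrite meetC; exact: (H y x Y X).
        have [[_ GI _] _] := Cgood _ CY.
        have [|Yxy] := GI x y (or_intror (XY _ Xx)) (or_intror Yy).
          by left.
        by right; exists Y.
    - move=> x y xy [Fx|[X CX Xx]]; first by left; exact: (filterS fF xy).
      have [[_ _ GS] _] := Cgood _ CX.
      have [|Xy] := GS x y xy (or_intror Xx); first by left.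
      by right; exists X.
  by case=> [/nFb|[X CX Xb]] //; have [_] := Cgood _ CX; apply; right.
have [X [[fG nGb] maxX]] := classical_sets.Zorn_bigcup chain.
exists (fun x => F x \/ X x); split=> //; first by left.
move=> x nGx; apply: contrapT => nE.
pose Y z := exists2 p, F p \/ X p & p `&` x <= z.
have GY z : F z \/ X z -> Y z by exists z => //; exact: leIl.
have FYY z : (F z \/ Y z) -> Y z by move=> [Fz|//]; apply: GY; left.
apply: (maxX Y).
  split; first by move=> z Xz; apply: GY; right.
  move=> YX; apply: nGx; right; apply: YX; exists \top; last exact: leIr.
  exact: filterT fG.
split; last by move=> /FYY.
split; first by right; exists \top; [exact: filterT fG|exact: lex1].
- move=> y z /FYY[p Gp py] /FYY[q Gq qz]; right.
  exists (p `&` q); first exact: (filterI fG).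
  rewrite lexI (le_trans _ py) ?(le_trans _ qz) //.
    by rewrite leI2 ?leIr.
  by rewrite leI2 ?leIl.
- by move=> y z yz /FYY[p Gp py]; right; exists p => //; exact: le_trans yz.
Qed.

Lemma prime_filter_separation a b : ~~ (a <= b) ->
  exists P, [/\ prime_filter P, P a & ~ P b].
Proof.
move=> nab.
have [P [fP aP nPb maxP]] :=
  exists_maximal_avoiding (principal_filter a) (negP nab : ~ (a <= b)).
exists P; split=> //; last exact: aP.
split=> // [P0|x y Pxy]; first by apply: nPb; exact: filterS fP _ _ (le0x b) P0.
apply: contrapT => /not_orP[/maxP[p Pp px] /maxP[q Pq qy]]; apply: nPb.
apply: filterS (filterI fP (filterI fP Pp Pq) Pxy) => //.
rewrite meetUr leUx (le_trans _ px) ?(le_trans _ qy) //.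
  by rewrite leI2 ?leIr.
by rewrite leI2 ?leIl.
Qed.

Lemma ultrafilter_extension F b : is_filter F -> ~ F (pcompl b) ->
  exists M, [/\ ultrafilter M, forall x, F x -> M x & M b].
Proof.
move=> fF nFb; pose G z := exists2 p, F p & p `&` b <= z.
have fG : is_filter G.
  split; first by exists \top; [exact: filterT fF|exact: lex1].
  - move=> y z [p Fp py] [q Fq qz].
    exists (p `&` q); first exact: (filterI fF).
    rewrite lexI (le_trans _ py) ?(le_trans _ qz) //.
      by rewrite leI2 ?leIr.
    by rewrite leI2 ?leIl.
  - by move=> y z yz [p Fp py]; exists p => //; exact: le_trans yz.
have nG0 : ~ G \bot.
  move=> [p Fp]; rewrite lex0 -le_pcompl => pb; apply: nFb.
  exact: filterS fF _ _ pb Fp.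
have [M [fM GM nM0 maxM]] := exists_maximal_avoiding fG nG0.
exists M; split.
- split=> // x /maxM[p Mp]; rewrite lex0 -le_pcompl => px.
  exact: filterS fM _ _ px Mp.
- by move=> x Fx; apply: GM; exists x => //; exact: leIl.
- by apply: GM; exists \top; [exact: filterT fF|exact: leIr].
Qed.

Lemma ultra_pcomplP M x : ultrafilter M -> M (pcompl x) <-> ~ M x.
Proof.
move=> uM; split; last exact: ultra_pcompl.
move=> Mxc Mx; apply: (ultra_proper uM).
by rewrite -(meetx_pcompl x); exact: (filterI uM).
Qed.

(** Disjoint from x and y, the element x^* /\ y^* is disjoint from x \/ y. *)
Lemma ultra_prime M : ultrafilter M -> prime_filter M.
Proof.
move=> uM; split=> [||x y Mxy]; [exact: uM|exact: (ultra_proper uM)|].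
apply: contrapT => /not_orP[/(ultra_pcompl uM) Mx /(ultra_pcompl uM) My].
apply: (ultra_proper uM).
apply: (filterS uM) (filterI uM (filterI uM Mx My) Mxy).
rewrite lex0 -le_pcompl le_pcomplC leUx -!(le_pcomplC (_ `&` _)).
by rewrite leIl leIr.
Qed.

Lemma ultra_neq M N : ultrafilter M -> ultrafilter N -> M <> N ->
  exists x, M x /\ ~ N x.
Proof.
move=> uM uN MN; apply: contrapT => nE; apply: MN.
have MN x : M x -> N x.
  by move=> Mx; apply: contrapT => nNx; apply: nE; exists x.
apply/predeqP => x; split; first exact: MN.
move=> Nx; apply: contrapT => /(ultra_pcomplP x uM) /MN.
by move/(ultra_pcomplP x uN).
Qed.

End PrimeFilters.

(** * Homomorphisms into [Bbar m] from narrow prime filters *)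

(** Any predicate has n distinct witnesses or fewer than n witnesses, which
    can then be listed; this is how m ultrafilters are counted. *)
Lemma enum_bounded_or_many (T : eqType) (S : T -> Prop) n :
  (exists s : seq T, [/\ uniq s, size s = n & forall x, x \in s -> S x]) \/
  (exists s : seq T, (size s < n)%N /\ forall x, S x <-> x \in s).
Proof.
elim: n => [|n [[s [us sn sS]]|[s [sn sS]]]]; first by left; exists [::].
- have [sall|] := pselect (forall x, S x -> x \in s).
    by right; exists s; rewrite sn; split=> // x; split=> [/sall|/sS].
  move=> /existsNP[x /not_implyP[Sx /negP xs]]; left; exists (x :: s).
  rewrite /= xs us sn; split=> // y; rewrite inE => /orP[/eqP->//|]; exact: sS.
- by right; exists s; split=> //; rewrite ltnS ltnW.
Qed.

Definition disjoint_family (A : palgebra) (I : eqType) (b : I -> A) :=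
  forall i j, i != j -> b i `&` b j = \bot.

Section Narrow.
Variables (A : palgebra) (m : nat).
Implicit Types (x y z b : A) (P M N : A -> Prop).

(** For a prime filter P this says that at most m ultrafilters contain P.
    Stated with elements of the algebra, it can be read off the quasi-identity
    when P is arbitrary, and off cardinalities in the algebras [Ualg n]. *)
Definition narrow P := forall b : 'I_m.+1 -> A,
  disjoint_family b -> exists i, P (pcompl (b i)).

(** With x_ij in M_i but not in M_j, the meet over j <> i of the elements x_ij
    /\ x_ji^* is in M_i, and two such meets are disjoint because one is below
    x_ij and the other below x_ij^*. *)
Lemma disjoint_ultrafilter_witnesses (I : finType) (M : I -> A -> Prop) :
  injective M -> (forall i, ultrafilter (M i)) ->
  exists2 b : I -> A, disjoint_family b & forall i, M i (b i).
Proof.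
move=> injM uM.
have /choice[x xP] : forall ij : I * I, exists y : A, ij.1 != ij.2 ->
    M ij.1 y /\ ~ M ij.2 y.
  case=> i j /=; have [->|ij] := eqVneq i j; first by exists \top.
  have [|y yP] := @ultra_neq _ _ _ (uM i) (uM j); last by exists y.
  by move/injM => e; rewrite e eqxx in ij.
pose b i : A := \meet_(j | j != i) (x (i, j) `&` pcompl (x (j, i))).
have bx i j : i != j -> b i <= x (i, j) `&` pcompl (x (j, i)).
  by move=> ij; apply: (meets_inf (j := j)); rewrite eq_sym.
exists b => [i j ij|i].
  apply/eqP; rewrite -lex0 -(meetx_pcompl (x (i, j))) leI2 //.
    exact: le_trans (bx i j ij) (leIl _ _).
  by apply: le_trans (bx j i _) (leIr _ _); rewrite eq_sym.
rewrite /b; elim/big_ind: _ => [|y z|j ji]; first exact: (filterT (uM i)).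
- exact: (filterI (uM i)).
- have ij : i != j by rewrite eq_sym.
  apply: (filterI (uM i)); first by have [] := xP (i, j) ij.
  by apply/(ultra_pcomplP _ (uM i)); have [] := xP (j, i) ji.
Qed.

(** The family may repeat ultrafilters, which lets its length be exactly m; so
    at least one ultrafilter above P is needed, and m must be positive. *)
Lemma narrow_ultrafilters P :
  (0 < m)%N -> is_filter P -> ~ P \bot -> narrow P ->
  exists M : 'I_m -> A -> Prop,
    [/\ forall i, ultrafilter (M i), forall i x, P x -> M i x
      & forall N, ultrafilter N -> (forall x, P x -> N x) -> exists i, N = M i].
Proof.
move=> m0 fP nP0 nP.
pose above N := ultrafilter N /\ forall x, P x -> N x.
have [[s [us sm sS]]|[s [sm sS]]] := enum_bounded_or_many above m.+1.
  pose M (i : 'I_m.+1) := nth P s i.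
  have aM i : above (M i) by apply: sS; rewrite mem_nth // sm.
  have injM : injective M.
    move=> i j /eqP; rewrite nth_uniq ?sm // => /eqP; exact: val_inj.
  have [b db bM] := disjoint_ultrafilter_witnesses injM (fun i => (aM i).1).
  have [i Pbi] := nP b db.
  by case/(ultra_pcomplP _ (aM i).1): ((aM i).2 _ Pbi).
have [M0 [uM0 PM0 _]] :
    exists M, [/\ ultrafilter M, forall x, P x -> M x & M \top].
  by apply: ultrafilter_extension => //; rewrite pcompl1.
have sM0 : M0 \in s by apply/sS.
pose M (i : 'I_m) := nth M0 s i.
have aM i : above (M i).
  by apply/sS; rewrite /M; case: (ltnP i (size s)) => si;
     [exact: mem_nth|rewrite nth_default].
exists M; split=> [i|i|N uN PN]; [exact: (aM i).1|exact: (aM i).2|].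
have /sS sN : above N by [].
have iN : (index N s < m)%N.
  by rewrite (leq_trans _ (sm : (size s <= m)%N)) ?index_mem.
by exists (Ordinal iN); rewrite /M /= nth_index.
Qed.

(** The poset dual to [Bbar k] has k maximal points above a least one; the map
    to be built is dual to sending the least one to P and the maximal ones to
    the M_i. That no ultrafilter above P is missing is expressed by [coverM]
    inside the algebra: an element in no M_i has its pseudocomplement in P. *)
Section ToBbar.
Variables (k : nat) (P : A -> Prop) (M : 'I_k -> A -> Prop).
Hypotheses (pP : prime_filter P) (uM : forall i, ultrafilter (M i)).
Hypothesis PM : forall i x, P x -> M i x.
Hypothesis coverM : forall x, (forall i, ~ M i x) -> P (pcompl x).

Definition to_Bbar x : Bbar k :=
  if `[< P x >] then None else Some [set i | `[< M i x >]].

Lemma to_Bbar_eq1 x : to_Bbar x = \top <-> P x.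
Proof. by rewrite /to_Bbar; case: asboolP. Qed.

Lemma to_Bbar_hom : palg_hom (to_Bbar : A -> (Bbar k : palgebra)).
Proof.
have MI i x y : `[< M i (x `&` y) >] = `[< M i x >] && `[< M i y >].
  rewrite -asbool_and; apply: asbool_equiv_eq; split=> [Mxy|[Mx My]].
    by split; apply: (filterS (uM i)) Mxy; rewrite ?leIl ?leIr.
  exact: (filterI (uM i)).
have MU i x y : `[< M i (x `|` y) >] = `[< M i x >] || `[< M i y >].
  rewrite -asbool_or; apply: asbool_equiv_eq; split.
    exact: (primeU (ultra_prime (uM i))).
  by case; apply: (filterS (uM i)); rewrite ?leUl ?leUr.
have MT i x : P x -> `[< M i x >] by move=> Px; apply/asboolP; exact: PM.
split=> [x y|x y|x||] /=; rewrite /to_Bbar.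
- rewrite -[RHS]/(Bbar_meet _ _).
  case: (asboolP (P x)) => Px; case: (asboolP (P y)) => Py;
      case: asboolP => Pxy //=.
  + by case: Pxy; exact: (filterI pP).
  + by case: Py; apply: (filterS pP) Pxy; exact: leIr.
  + by congr Some; apply/setP => i; rewrite !inE MI MT.
  + by case: Px; apply: (filterS pP) Pxy; exact: leIl.
  + by congr Some; apply/setP => i; rewrite !inE MI (MT _ _ Py) andbT.
  + by case: Px; apply: (filterS pP) Pxy; exact: leIl.
  + by congr Some; apply/setP => i; rewrite !inE MI.
- rewrite -[RHS]/(Bbar_join _ _).
  case: (asboolP (P x)) => Px; case: (asboolP (P y)) => Py;
      case: asboolP => Pxy //=.
  1-3: by case: Pxy; apply: (filterS pP) (Px) || apply: (filterS pP) (Py);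
          rewrite ?leUl ?leUr.
  + by case/(primeU pP): Pxy.
  + by congr Some; apply/setP => i; rewrite !inE MU.
- rewrite -[RHS]/(Bbar_pcompl _).
  case: (asboolP (P x)) => Px /=.
    case: asboolP => Pxc.
      case: (prime_proper pP); rewrite -(meetx_pcompl x).
      exact: (filterI pP).
    congr Some; apply/setP => i; rewrite !inE; apply/asboolP.
    by move/(ultra_pcomplP _ (uM i)); apply; exact: PM.
  case: eqP => [x0|/eqP/set0Pn[i]].
    case: asboolP => // -[]; apply: coverM => i Mx.
    by have := in_set0 i; rewrite -x0 inE => /asboolP.
  rewrite inE => /asboolP Mx; case: asboolP => Pxc.
    by move/(ultra_pcomplP _ (uM i)): (PM i Pxc).
  congr Some; apply/setP => j; rewrite !inE -asbool_neg.
  apply: asbool_equiv_eq; exact: ultra_pcomplP.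
- case: asboolP => [/(prime_proper pP)//|_]; congr Some.
  apply/setP => i; rewrite !inE; apply/asboolP; exact: (ultra_proper (uM i)).
- case: asboolP => // -[]; exact: (filterT pP).
Qed.

End ToBbar.

Lemma narrow_prime_hom P : (0 < m)%N -> prime_filter P -> narrow P ->
  exists2 h : A -> (Bbar m : palgebra), palg_hom h
    & forall x, h x = \top <-> P x.
Proof.
move=> m0 pP nP.
have [M [uM PM allM]] := narrow_ultrafilters m0 pP (prime_proper pP) nP.
exists (to_Bbar P M); last exact: to_Bbar_eq1.
apply: to_Bbar_hom => // x nMx; apply: contrapT => nPx.
have [N [uN PN Nx]] := ultrafilter_extension pP nPx.
by have [i Ni] := allM N uN PN; apply: (nMx i); rewrite -Ni.
Qed.

End Narrow.

(** * Powers of an algebra *)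

Section Power.
Variables (I : Type) (B : palgebra).

Definition power := I -> B.
HB.instance Definition _ := gen_eqMixin power.
HB.instance Definition _ := gen_choiceMixin power.

Implicit Types f g h : power.
Definition power_meet f g : power := fun i => f i `&` g i.
Definition power_join f g : power := fun i => f i `|` g i.
Definition power_pcompl f : power := fun i => pcompl (f i).
Definition power_le f g := power_meet f g == f.
Definition power_lt f g := (g != f) && power_le f g.

Fact power_leE f g : power_le f g = (power_meet f g == f).
Proof. by []. Qed.
Fact power_ltE f g : power_lt f g = (g != f) && power_le f g.
Proof. by []. Qed.
Fact power_meetC : commutative power_meet.
Proof. by move=> f g; apply/funext => i; exact: meetC. Qed.
Fact power_joinC : commutative power_join.
Proof. by move=> f g; apply/funext => i; exact: joinC. Qed.
Fact power_meetA : associative power_meet.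
Proof. by move=> f g h; apply/funext => i; exact: meetA. Qed.
Fact power_joinA : associative power_join.
Proof. by move=> f g h; apply/funext => i; exact: joinA. Qed.
Fact power_joinKI g f : power_meet f (power_join f g) = f.
Proof. by apply/funext => i; exact: joinKI. Qed.
Fact power_meetKU g f : power_join f (power_meet f g) = f.
Proof. by apply/funext => i; exact: meetKU. Qed.
Fact power_meetUl : left_distributive power_meet power_join.
Proof. by move=> f g h; apply/funext => i; exact: meetUl. Qed.
Fact power_meetxx : idempotent_op power_meet.
Proof. by move=> f; apply/funext => i; exact: meetxx. Qed.

HB.instance Definition _ :=
  Order.isMeetJoinDistrLattice.Build palg_display power
    power_leE power_ltE power_meetC power_joinC power_meetA power_joinA
    power_joinKI power_meetKU power_meetUl power_meetxx.

Fact power_le0x f : ((fun=> \bot) : power) <= f.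
Proof. by rewrite leEmeet; apply/eqP/funext => i; exact: meet0x. Qed.
Fact power_lex1 f : f <= ((fun=> \top) : power).
Proof. by rewrite leEmeet; apply/eqP/funext => i; exact: meetx1. Qed.

HB.instance Definition _ := Order.hasBottom.Build _ power power_le0x.
HB.instance Definition _ := Order.hasTop.Build _ power power_lex1.

Fact power_pcomplP f g : (f `&` g == \bot) = (f <= power_pcompl g).
Proof.
rewrite leEmeet; apply/eqP/eqP => fg; apply/funext => i.
  have : (f `&` g) i = \bot by rewrite fg.
  by move/eqP; rewrite pcomplP leEmeet => /eqP.
by apply/eqP; rewrite pcomplP leEmeet -[X in _ == X](congr1 (@^~ i) fg).
Qed.

HB.instance Definition _ := hasPseudocomplement.Build _ power power_pcomplP.

End Power.

Lemma opS_power (K : palg_class) (A B : palgebra) : K B ->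
  (forall x y : A, x <> y -> exists2 h : A -> B, palg_hom h & h x <> h y) ->
  opS (opP K) A.
Proof.
move=> KB sepA; pose I := {h : A -> B | palg_hom h}.
exists (power I B), (fun a (h : I) => sval h a).
split=> [||x y fxy].
- exists I, (fun=> B), (fun i f => f i); split=> // b.
  by exists b; split=> // a ab; apply/funext => i.
- by split=> [x y|x y|x||]; apply/funext => -[h /= []].
- apply: contrapT => /sepA[h hh]; apply.
  exact: (congr1 (fun F : power I B => F (exist _ h hh)) fxy).
Qed.

(** * Lee's condition and the variety [Pa m] *)

(** Lee's identity for Pa_m, in quasi-identity form: disjointness replaces the
    explicit disjoint terms x_1 /\ .. /\ x_i^* /\ .. /\ x_m. *)
Definition Lee m (A : palgebra) := forall b : 'I_m.+1 -> A,
  disjoint_family b -> \join_i pcompl (b i) = \top.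

Lemma prime_joins (A : palgebra) (P : A -> Prop) (I : finType) (F : I -> A) :
  prime_filter P -> P (\join_i F i) -> exists i, P (F i).
Proof.
move=> pP; elim/big_ind: _ => [/(prime_proper pP)//|x y Px Py|i _ Pi].
  by case/(primeU pP).
by exists i.
Qed.

(** Since the join of the b_i^* is 1, one of them is in any given prime
    filter: so all prime filters are narrow, and those separate the points. *)
Lemma Lee_separated m (A : palgebra) (x y : A) : (0 < m)%N -> Lee m A ->
  x <> y -> exists2 h : A -> (Bbar m : palgebra), palg_hom h & h x <> h y.
Proof.
move=> m0 leeA xy.
wlog nxy : x y xy / ~~ (x <= y).
  move=> H; case/boolP: (x <= y) => [lxy|]; last exact: H.
  have [|h hh hxy] := H y x (nesym xy); last by exists h => //; exact: nesym.
  by apply/negP => lyx; apply: xy; apply/eqP; rewrite eq_le lxy lyx.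
have [P [pP Px nPy]] := prime_filter_separation nxy.
have nP : narrow m P.
  move=> b /leeA Eb; apply: (prime_joins pP); rewrite Eb.
  exact: (filterT pP).
have [h hh h1] := narrow_prime_hom m0 pP nP.
by exists h => // hxy; apply: nPy; apply/h1; rewrite -hxy; apply/h1.
Qed.

Lemma palg_hom_id (A : palgebra) : palg_hom (id : A -> A).
Proof. by []. Qed.

Lemma palg_hom_joins (A B : palgebra) (f : A -> B) (I : finType) (F : I -> A) :
  palg_hom f -> f (\join_i F i) = \join_i f (F i).
Proof. by move=> [_ fU _ f0 _]; apply: (big_morph f fU f0). Qed.

(** Preimages b_i of a disjoint family need not be disjoint, but replacing b_i
    by b_i /\ (\join_(j <> i) b_j)^* makes them so without changing the
    images. *)
Lemma Lee_opH m (K : palg_class) A : subclass K (Lee m) -> opH K A -> Lee m A.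
Proof.
move=> leeK [B [f [/leeK leeB hf fsurj]]] a da.
have /choice[b fb] : forall i, exists b, f b = a i by move=> i; exact: fsurj.
pose b' i : B := b i `&` pcompl (\join_(j | j != i) b j).
have fb' i : f (b' i) = a i.
  have [fI fU fN f0 _] := hf.
  rewrite /b' fI fN fb (big_morph f fU f0); apply/meet_idPl.
  apply/le_pcompl_joins => j ji; rewrite fb; apply: da; by rewrite eq_sym.
have db' : disjoint_family b'.
  move=> i j ij; apply/eqP; rewrite -lex0 -(meetx_pcompl (b j)) meetC.
  rewrite leI2 ?leIl // (le_trans (leIr _ _)) //; apply: pcompl_anti.
  by apply: (joins_sup (j := j)); rewrite eq_sym.
have [_ _ fN _ f1] := hf.
rewrite -f1 -(leeB b' db') palg_hom_joins //.
by apply: eq_bigr => i _; rewrite fN fb'.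
Qed.

Lemma Lee_opS m (K : palg_class) A : subclass K (Lee m) -> opS K A -> Lee m A.
Proof.
move=> leeK [B [f [/leeK leeB hf finj]]] a da; apply: finj.
have [fI _ fN f0 f1] := hf.
rewrite palg_hom_joins // f1 -(leeB (f \o a)).
  by apply: eq_bigr => i _; rewrite fN.
by move=> i j ij /=; rewrite -fI da.
Qed.

Lemma Lee_opP m (K : palg_class) A : subclass K (Lee m) -> opP K A -> Lee m A.
Proof.
move=> leeK [I [B [p [KB hp puniq]]]] a da.
have [c [_ cuniq]] := puniq (fun i => p i \top).
rewrite -(cuniq \top (fun=> erefl)); apply/esym/cuniq => i.
have [fI _ fN f0 f1] := hp i.
rewrite palg_hom_joins // f1 -(leeK _ (KB i) (p i \o a)).
  by apply: eq_bigr => j _; rewrite fN.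
by move=> j k jk /=; rewrite -fI da.
Qed.

(** Positivity of m matters: m + 1 >= 2 disjoint elements, one of which is the
    top, include the bottom; for m = 0 the family consisting of the top alone
    would be a counterexample. *)
Lemma Lee_Bbar m : (0 < m)%N -> Lee m (Bbar m : palgebra).
Proof.
move=> m0 b db.
have [i bi0] : exists i, b i = \bot.
  apply: contrapT => nb0.
  have b0 i : b i != \bot by apply/eqP => bi0; apply: nb0; exists i.
  have ztop i : b i != None.
    apply/eqP => bi; pose j : 'I_m.+1 := if i == ord0 then ord_max else ord0.
    have ij : i != j.
      rewrite /j; have [->|//] := eqVneq i ord0.
      by rewrite -val_eqE /= eq_sym -lt0n.
    have := db i j ij; rewrite bi -[_ `&` _]/(b j).
    by apply/eqP; exact: b0.
  have /choice[z zP] : forall i, exists z, z \in odflt set0 (b i).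
    move=> i; apply/set0Pn; case: (b i) (b0 i) (ztop i) => [X|_ /eqP//].
    by move=> + _; apply: contraNN => /eqP /= ->.
  have zinj : injective z.
    move=> i j zij; apply: contrapT => /eqP ij.
    have := zP j; have := zP i; rewrite -zij; have := db i j ij.
    case: (b i) (ztop i) (b j) (ztop j) => [X _|/eqP//] [Y _|/eqP//].
    move=> [XY] /= zX zY; have := in_set0 (z i).
    by rewrite -[set0]XY inE zX zY.
  by have := leq_card z zinj; rewrite !card_ord ltnn.
have := joins_sup (fun i => pcompl (b i)) (isT : xpredT i).
by rewrite bi0 pcompl0 le1x => /eqP.
Qed.

Lemma Pa_Lee m A : (0 < m)%N -> Pa m A <-> Lee m A.
Proof.
move=> m0; split=> [|leeA].
  apply: Lee_opH => B; apply: Lee_opS => C; apply: Lee_opP => _ ->.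
  exact: Lee_Bbar.
exists A, id; split=> [||a]; [|exact: palg_hom_id|by exists a].
apply: (@opS_power _ _ (Bbar m)) => // x y xy.
exact: Lee_separated.
Qed.

(** * Quasivarieties *)

Lemma peval_hom (A B : palgebra) (h : A -> B) v t :
  palg_hom h -> h (peval v t) = peval (h \o v) t.
Proof.
move=> [hI hU hN h0 h1].
by elim: t => //= [s <- t <-|s <- t <-|t <-]; rewrite ?hI ?hU ?hN.
Qed.

(** Quasivarieties are closed under subdirect products: a failure of a
    quasi-identity in A survives in the algebra where a homomorphism separates
    the two sides of its conclusion. *)
Lemma quasivariety_separated (K : palg_class) (A : palgebra) :
  is_quasivariety K ->
  (forall x y : A, x <> y ->
    exists (B : palgebra) (h : A -> B), [/\ K B, palg_hom h & h x <> h y]) ->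
  K A.
Proof.
move=> [Sigma KE] sepA; apply/KE => q Sq v vprem; apply: contrapT => /sepA.
move=> [B [h [/KE/(_ q Sq)/(_ (h \o v)) Bq hh]]]; apply.
rewrite !peval_hom //; apply: Bq => e /vprem.
by rewrite /eq_holds -!peval_hom // => ->.
Qed.

Lemma quasivariety_generated_quasivariety (G : palg_class) :
  is_quasivariety (quasivariety_generated G).
Proof.
exists (fun q => forall B, G B -> satisfies B q) => A; split=> [GA q Gq|Aq K].
  apply: (GA (fun B => satisfies B q)); last by move=> B /Gq.
  by exists (eq q) => B; split=> [Bq _ <-//|]; apply.
move=> [Sigma KE] GK; apply/KE => q Sq; apply: Aq => B /GK /KE; exact.
Qed.

Definition Lee_quasi_identity m : quasi_identity := QuasiIdentity
  [seq (TMeet (TVar ij.1) (TVar ij.2), TBot) |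
    ij <- [seq (i, j) | i <- iota 0 m.+1, j <- iota 0 m.+1] & ij.1 != ij.2]
  (foldr (fun i t => TJoin (TPcompl (TVar i)) t) TBot (iota 0 m.+1), TTop).

Lemma In_map (T : eqType) (U : Type) (f : T -> U) s u :
  List.In u (map f s) <-> exists2 x, x \in s & u = f x.
Proof.
elim: s => [|x s IHs] /=; first by split=> // -[].
split=> [[<-|/IHs[y ys ->]]|[y]]; first by exists x; rewrite ?mem_head.
  by exists y; rewrite // inE ys orbT.
by rewrite inE => /orP[/eqP->|ys] uE; [left|right; apply/IHs; exists y].
Qed.

Lemma satisfies_Lee m A : satisfies A (Lee_quasi_identity m) <-> Lee m A.
Proof.
have evalE (v : nat -> A) :
    eq_holds v (qi_conclusion (Lee_quasi_identity m)) <->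
    \join_(i < m.+1) pcompl (v i) = \top.
  rewrite -(big_mkord xpredT (fun i => pcompl (v i))) /index_iota subn0.
  rewrite /eq_holds /Lee_quasi_identity; move: (iota 0 m.+1) => s /=.
  suff -> : peval v (foldr (fun i => TJoin (TPcompl (TVar i))) TBot s) =
      \join_(i <- s) pcompl (v i) by [].
  by elim: s => [|i s IHs]; rewrite ?big_nil ?big_cons //= IHs.
split=> [Aq b db|leeA v vprem].
  have /evalE <- : eq_holds (fun i => b (inord i))
      (qi_conclusion (Lee_quasi_identity m)).
    apply: Aq => e /In_map[[i j]]; rewrite mem_filter => /andP[ij].
    move=> /allpairsPdep[i' [j' [im jm [ei ej]]]] ->; subst i' j'.
    move: im jm; rewrite !mem_iota /= add0n => im jm.
    by rewrite /eq_holds /= db // -val_eqE /= !inordK.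
  by apply: eq_bigr => i _; rewrite inord_val.
apply/evalE; apply: (leeA (fun i => v i)) => i j ij.
apply: (vprem (TMeet (TVar i) (TVar j), TBot)); apply/In_map.
exists (val i, val j) => //; rewrite mem_filter; apply/andP; split=> //.
apply/allpairsPdep; exists (val i), (val j).
by rewrite !mem_iota /= !add0n !ltn_ord.
Qed.

Lemma Pa_quasivariety m : (0 < m)%N -> is_quasivariety (Pa m).
Proof.
move=> m0; exists (eq (Lee_quasi_identity m)) => A.
rewrite (Pa_Lee _ m0) -satisfies_Lee; split=> [Aq _ <-//|]; exact.
Qed.

Lemma Pa_sub_quasivariety m (K : palg_class) : (0 < m)%N ->
  is_quasivariety K -> K (Bbar m : palgebra) -> subclass (Pa m) K.
Proof.
move=> m0 qK KB A /(Pa_Lee _ m0) leeA; apply: quasivariety_separated => // x y.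
move=> /(Lee_separated m0 leeA)[h hh hxy].
by exists (Bbar m), h.
Qed.

(** * The algebra [Ualg n] *)

Section Membership.
Variable n : nat.
Implicit Types (W V : Ualg n) (Y Z : Uposet n).

Definition umem Y W : bool := Y \in upset_val W.

Lemma umem_up Y Z W : val Z \subset val Y -> umem Y W -> umem Z W.
Proof. by case: W => W hW ZY; have /upsetP up := hW; move=> /up; apply. Qed.

Lemma umemI Y W V : umem Y (W `&` V) = umem Y W && umem Y V.
Proof.
by rewrite /umem -[upset_val (_ `&` _)]/(upset_val W :&: upset_val V) inE.
Qed.

Lemma umemU Y W V : umem Y (W `|` V) = umem Y W || umem Y V.
Proof.
by rewrite /umem -[upset_val (_ `|` _)]/(upset_val W :|: upset_val V) inE.
Qed.

Lemma umem0 Y : umem Y \bot = false.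
Proof. by rewrite /umem -[upset_val \bot]/(set0 : {set Uposet n}) inE. Qed.

Lemma umem1 Y : umem Y \top.
Proof. by rewrite /umem -[upset_val \top]/([set: Uposet n]) inE. Qed.

Lemma umem_pcompl Y W :
  reflect (forall Z, val Z \subset val Y -> ~~ umem Z W) (umem Y (pcompl W)).
Proof.
rewrite /umem -[upset_val (pcompl W)]/(upset_pcompl_set W) inE.
by apply: (iffP forallP) => YW Z; [move/implyP: (YW Z)|apply/implyP/YW].
Qed.

Lemma umemS Y W V : W <= V -> umem Y W -> umem Y V.
Proof. by move=> /meet_idPl <-; rewrite umemI => /andP[]. Qed.

Lemma umem_ext W V : (forall Y, umem Y W = umem Y V) -> W = V.
Proof. by move=> WV; apply/val_inj/setP. Qed.

Lemma umem_prime Y : prime_filter (umem Y).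
Proof.
split=> [||W V]; last by rewrite umemU => /orP.
  split=> [|W V WY VY|W V]; rewrite ?umem1 ?umemI ?WY //; exact: umemS.
by rewrite umem0.
Qed.

Definition usingleton i : Uposet n := exist (fun A : {set 'I_n} => A != set0)
  [set i] (introT (set0Pn _) (ex_intro _ i (set11 i))).

(** The ultrafilters above the prime filter of Y correspond to the elements of
    Y. If no b_i^* contains Y, then each b_i contains a singleton {z_i} with
    z_i in Y, and disjointness makes the z_i distinct. *)
Lemma umem_narrow m Y : (#|val Y| <= m)%N -> narrow m (umem Y).
Proof.
move=> Ym b db; apply: contrapT => nb.
have /choice[z zP] : forall i, exists z,
    z \in val Y /\ umem (usingleton z) (b i).
  move=> i; apply: contrapT => nz; apply: nb; exists i; apply/umem_pcompl.
  move=> Z ZY; apply/negP => Zb; have /set0Pn[z zZ] := valP Z.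
  apply: nz; exists z; split; first exact: subsetP ZY z zZ.
  by apply: umem_up Zb; rewrite sub1set.
have zinj : injective z.
  move=> i j zij; apply: contrapT => /eqP /db bij.
  have := umem0 (usingleton (z i)).
  by rewrite -bij umemI (zP i).2 zij (zP j).2.
have : (#|[set z i | i : 'I_m.+1]| <= #|val Y|)%N.
  by apply/subset_leq_card/subsetP => _ /imsetP[i _ ->]; case: (zP i).
by rewrite card_imset // card_ord => /(leq_ltn_trans Ym); rewrite ltnn.
Qed.

End Membership.

(** The full set is in no b_i^* when b_i is the upset of the singleton {i}. *)
Lemma Ualg_not_Lee m : ~ Lee m (Ualg m.+1).
Proof.
have up (i : 'I_m.+1) : is_upset [set usingleton i].
  apply/upsetP => x y; rewrite !inE => /eqP-> iy; apply/eqP/val_inj/eqP.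
  have: val y \subset [set i] by [].
  by rewrite subset1 (negPf (valP y)) orbF.
pose b i : Ualg m.+1 := Upset (up i).
have db : disjoint_family b.
  move=> i j ij; apply: umem_ext => Y; rewrite umem0 umemI /umem /= !inE.
  apply/negP => /andP[/eqP-> /eqP/(congr1 val)/= /set1_inj ji].
  by rewrite ji eqxx in ij.
move=> /(_ b db) E.
have nT : [set: 'I_m.+1] != set0 by apply/set0Pn; exists ord0; rewrite inE.
pose T : Uposet m.+1 := exist _ [set: 'I_m.+1] nT.
have [i /umem_pcompl Ti] : exists i, umem T (pcompl (b i)).
  by apply: (prime_joins (umem_prime T)); rewrite E umem1.
by have := Ti (usingleton i) (subsetT _); rewrite /umem /= inE eqxx.
Qed.

(** * Homomorphisms out of [Ualg n] *)

Section DenseFamily.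
Variables (n : nat) (A : palgebra) (c : 'I_n -> A).
Hypotheses (n0 : (0 < n)%N) (dc : disjoint_family c).
Hypothesis densec : pcompl (\join_i c i) = \bot.
Implicit Types (S T : {set 'I_n}) (x y : A) (W V : Ualg n).

(** The join of the c_i with i in S in the Boolean algebra of regular
    elements. Taking the pseudocomplement over the other indices, rather than
    the double pseudocomplement over S, makes it regular by construction and
    turns meets into intersections of index sets. *)
Definition regular_join S : A := pcompl (\join_(i | i \notin S) c i).
Local Notation r := regular_join.

Lemma le_regular_join x S :
  x <= r S <-> forall i, i \notin S -> x `&` c i = \bot.
Proof. exact: le_pcompl_joins. Qed.

Lemma regular_join0 : r set0 = \bot.
Proof.
by rewrite -densec /r; congr pcompl; apply: eq_bigl => i; rewrite inE.
Qed.

Lemma regular_joinT : r setT = \top.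
Proof.
by apply/eqP; rewrite -le1x; apply/le_regular_join => i; rewrite inE.
Qed.

Lemma regular_joinI S T : r S `&` r T = r (S :&: T).
Proof.
apply/eqP; rewrite eq_le; apply/andP; split.
  apply/le_regular_join => i; rewrite inE negb_and => /orP[] iN.
    rewrite meetAC; have /le_regular_join -> // := lexx (r S).
    exact: meet0x.
  rewrite -meetA; have /le_regular_join -> // := lexx (r T).
  exact: meetx0.
by rewrite lexI; apply/andP; split; apply/le_regular_join => i iN;
  have /le_regular_join -> // := lexx (r (S :&: T));
  rewrite inE negb_and iN ?orbT.
Qed.

Lemma le_regular_join_mem i S : i \in S -> c i <= r S.
Proof.
move=> iS; apply/le_regular_join => j jS; apply: dc.
by apply: contraNneq jS => <-.
Qed.

(** An upset of nonempty sets ordered by reverse inclusion is the join of the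
    regular elements of [Ualg n] given by the powersets of its members, so
    this is the only candidate extending S |-> r S. *)
Definition Ualg_eval W : A := \join_(Y | umem Y W) r (val Y).
Local Notation f := Ualg_eval.

Lemma Ualg_eval_sup Y W : umem Y W -> r (val Y) <= f W.
Proof. by move=> YW; apply: (joins_sup (j := Y)). Qed.

Lemma Ualg_eval_mono W V : W <= V -> f W <= f V.
Proof.
by move=> WV; apply/joinsP => Y YW; apply: Ualg_eval_sup; exact: umemS YW.
Qed.

Lemma meet_joins (I : finType) (Q : pred I) (F : I -> A) x :
  x `&` \join_(i | Q i) F i = \join_(i | Q i) (x `&` F i).
Proof. exact: (big_morph (Order.meet x) (meetUr x) (meetx0 x)). Qed.

Lemma Ualg_evalI W V : f (W `&` V) = f W `&` f V.
Proof.
apply/eqP; rewrite eq_le; apply/andP; split.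
  by rewrite lexI !Ualg_eval_mono ?leIl ?leIr.
rewrite {2}/f meet_joins; apply/joinsP => Z ZV.
rewrite meetC meet_joins; apply/joinsP => Y YW; rewrite meetC regular_joinI.
have [->|YZ] := eqVneq (val Y :&: val Z) set0.
  by rewrite regular_join0 le0x.
pose X : Uposet n := exist (fun B => B != set0) (val Y :&: val Z) YZ.
apply: (Ualg_eval_sup (Y := X)); rewrite umemI.
by rewrite (umem_up _ YW) ?subsetIl // (umem_up _ ZV) // subsetIr.
Qed.

Lemma Ualg_evalU W V : f (W `|` V) = f W `|` f V.
Proof.
apply/eqP; rewrite eq_le; apply/andP; split; last first.
  by rewrite leUx !Ualg_eval_mono ?leUl ?leUr.
apply/joinsP => Y; rewrite umemU => /orP[] /Ualg_eval_sup /le_trans; apply.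
  exact: leUl.
exact: leUr.
Qed.

Lemma Ualg_eval0 : f \bot = \bot.
Proof. by apply: big_pred0 => Y; rewrite umem0. Qed.

Lemma Ualg_eval1 : f \top = \top.
Proof.
have nT : [set: 'I_n] != set0 by apply/set0Pn; exists (Ordinal n0); rewrite inE.
apply/eqP; rewrite -le1x -regular_joinT.
pose T : Uposet n := exist (fun B => B != set0) setT nT.
by apply: (Ualg_eval_sup (Y := T)); rewrite umem1.
Qed.

(** The pseudocomplement of W is the set of nonempty subsets of the complement
    of U, the union of W; both sides equal r (~: U). *)
Lemma Ualg_evalC W : f (pcompl W) = pcompl (f W).
Proof.
apply/eqP; rewrite eq_le; apply/andP; split.
  by rewrite le_pcompl -Ualg_evalI meetC meetx_pcompl Ualg_eval0.
pose U := \bigcup_(Y | umem Y W) val Y.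
have leU : pcompl (f W) <= r (~: U).
  apply/le_regular_join => i; rewrite inE negbK => /bigcupP[Y YW iY].
  apply/eqP; rewrite -lex0 -(meetx_pcompl (f W)) meetC leI2 //.
  exact: le_trans (le_regular_join_mem iY) (Ualg_eval_sup YW).
have [U0|UN] := eqVneq (~: U) set0.
  by rewrite (le_trans leU) // U0 regular_join0 le0x.
pose X : Uposet n := exist (fun B => B != set0) (~: U) UN.
apply: le_trans leU (Ualg_eval_sup (Y := X) _); apply/umem_pcompl.
move=> Z /= ZU; apply/negP => ZW; have /set0Pn[i iZ] := valP Z.
have := subsetP ZU i iZ; rewrite inE => /negP; apply.
by apply/bigcupP; exists Z.
Qed.

Lemma Ualg_eval_hom : palg_hom Ualg_eval.
Proof.
by split; [exact: Ualg_evalI|exact: Ualg_evalU|exact: Ualg_evalC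
  |exact: Ualg_eval0|exact: Ualg_eval1].
Qed.

Lemma Ualg_eval_neq1 W : W != \top -> f W <= \join_i pcompl (c i).
Proof.
move=> W1; apply/joinsP => Y YW.
have [i iY] : exists i, i \notin val Y.
  apply/existsP; apply: contraNT W1; rewrite negb_exists => /forallP YT.
  apply/eqP/umem_ext => Z; rewrite umem1; apply: umem_up YW.
  by apply/subsetP => i _; have := YT i; rewrite negbK.
apply: le_trans (joins_sup (fun i => pcompl (c i)) (isT : xpredT i)).
by rewrite le_pcompl; apply/eqP/(le_regular_join _ _).1.
Qed.

End DenseFamily.

(** Enlarging the failing family b to c, by replacing b_0 with (\join_(j <> 0)
    b_j)^*, makes its join dense and keeps it disjoint; the join of the
    pseudocomplements can only decrease, so it remains different from 1. *)
Lemma not_Lee_hom m (A : palgebra) : ~ Lee m A ->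
  exists2 f : Ualg m.+1 -> A, palg_hom f & forall W, f W = \top -> W = \top.
Proof.
move=> /existsNP[b /not_implyP[db nb]].
pose c i : A := if i == ord0 then pcompl (\join_(j | j != ord0) b j) else b i.
have c0 i : i != ord0 -> c ord0 `&` b i = \bot.
  by move: i; apply/le_pcompl_joins; rewrite /c eqxx.
have dc : disjoint_family c.
  move=> i j; have [->|i0] := eqVneq i ord0; have [->|j0] := eqVneq j ord0.
  - by [].
  - by move=> _; rewrite {2}/c (negPf j0) c0.
  - by move=> _; rewrite {1}/c (negPf i0) meetC c0.
  - by rewrite /c (negPf i0) (negPf j0); exact: db.
have bc i : b i <= c i.
  rewrite /c; case: eqP => // ->; apply/le_pcompl_joins => j j0.
  by apply: db; rewrite eq_sym.
have densec : pcompl (\join_i c i) = \bot.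
  set y := pcompl _; have yc i : y `&` c i = \bot.
    by have /le_pcompl_joins := lexx y; apply.
  have yc0 : y <= c ord0.
    rewrite /c eqxx; apply/le_pcompl_joins => j j0.
    by rewrite -(yc j) /c (negPf j0).
  by rewrite -(meet_l yc0) yc.
exists (Ualg_eval c); first exact: Ualg_eval_hom.
move=> W fW; apply/eqP; apply: contrapT => /negP /(Ualg_eval_neq1 c).
rewrite fW le1x => /eqP c1; apply: nb; apply/eqP; rewrite -le1x -c1.
apply/joinsP => i _; apply: le_trans (pcompl_anti (bc i)) _.
exact: (joins_sup (fun i => pcompl (b i))).
Qed.

(** * The covers of [Pa m] *)

(** Points of the dual poset with at most m elements are reached by [Bbar m];
    the only remaining one, the full set, is reached by A. *)
Lemma Ualg_in_quasivariety m (K : palg_class) (A : palgebra) : (0 < m)%N ->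
  is_quasivariety K -> K (Bbar m : palgebra) -> K A -> ~ Lee m A ->
  K (Ualg m.+1).
Proof.
move=> m0 qK KB KA nA; apply: quasivariety_separated => // W V WV.
have [Y YWV] : exists Y, umem Y W != umem Y V.
  apply: contrapT => nY; apply: WV; apply: umem_ext => Y.
  by apply/eqP; apply: contrapT => /negP YWV; apply: nY; exists Y.
have [Ym|mY] := leqP #|val Y| m.
  have [h hh h1] := narrow_prime_hom m0 (umem_prime Y) (umem_narrow Ym).
  exists (Bbar m), h; split=> // hWV; move/eqP: YWV; apply.
  by apply/idP/idP => /h1; [rewrite hWV|rewrite -hWV] => /h1.
have YT : val Y = setT.
  by apply/eqP; rewrite eqEcard subsetT cardsT card_ord.
have top_of X : umem Y X -> X = \top.
  move=> YX; apply: umem_ext => Z; rewrite umem1; apply: umem_up YX.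
  by rewrite YT subsetT.
have [f hf f1] := not_Lee_hom nA; exists A, f; split=> // fWV.
have [_ _ _ _ ft] := hf.
move: YWV; case YW: (umem Y W); case YV: (umem Y V) => // _; apply: WV.
  by rewrite (top_of _ YW) (f1 V) // -fWV (top_of _ YW).
by rewrite (top_of _ YV) (f1 W) // fWV (top_of _ YV).
Qed.

End Palgebras.

Theorem theorem3p3 (m : nat) (hm : (1 <= m)%N) :
  let Q := quasivariety_generated
             (fun A => A = (Bbar m : palgebra) \/ A = Ualg m.+1) in
  is_cover Q (Pa m) /\ forall K, is_cover K (Pa m) -> eqclass K Q.
Proof.
move=> Q.
have qPa := Pa_quasivariety hm.
have qQ : is_quasivariety Q by exact: quasivariety_generated_quasivariety.
have QB : Q (Bbar m : palgebra) by move=> K _; apply; left.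
have QU : Q (Ualg m.+1) by move=> K _; apply; right.
have PaB : Pa m (Bbar m : palgebra) by apply/(Pa_Lee _ hm)/Lee_Bbar.
have minQ M : is_quasivariety M -> properclass (Pa m) M -> subclass Q M.
  move=> qM [PaM nMPa] A QA; apply: QA => // _ [->|->]; first exact: PaM.
  have [B [MB nB]] : exists B, M B /\ ~ Lee m B.
    apply: contrapT => nE; apply: nMPa => B MB; apply/(Pa_Lee _ hm).
    by apply: contrapT => nB; apply: nE; exists B.
  exact: (Ualg_in_quasivariety hm qM (PaM _ PaB) MB nB).
have PaQ : properclass (Pa m) Q.
  split; first exact: Pa_sub_quasivariety.
  by move=> /(_ _ QU)/(Pa_Lee _ hm); exact: Ualg_not_Lee.
split.
  split=> // -[M [qM PaM [MQ nQM]]]; apply: nQM; exact: minQ.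
move=> K [_ qK PaK nK] A; have QK := minQ K qK PaK.
split; last exact: QK.
move=> KA; apply: contrapT => nQA; apply: nK.
by exists Q; split=> //; split=> // /(_ A KA).
Qed.
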